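(* Let $\Pi$ be a plane. Then $\Pi$ satisfies the Strong Pasch Condition: for every three different points $A,B,C$ of $\Pi$, every maximal line in $\Pi$ that intersects one of the sides $s[A,B]$, $s[B,C]$, $s[A,C]$ of the triangle $\Delta(ABC)$ must intersect another side as well.
   Context: A betweenness relation on a set $\Pi$ is a ternary relation ''$C$ is between $A$ and $B$'' such that, writing $s[A,B]$ for the set of all points between $A$ and $B$: (a) each point is between itself and any point of $\Pi$; (b) if $A$ is between $B$ and $C$, then $A$ is between $C$ and $B$; (c) if $C\in s[A,B]$, then $s[A,B]=s[A,C]\cup s[C,B]$ and $s[A,C]\cap s[C,B]=s[C,C]=\{C\}$. A closed line segment is a set of the form $s[A,B]$; its interior is $s(A,B)=s[A,B]\setminus\{A,B\}$. A subset $S$ is convex if $s[A,B]\subset S$ for all $A,B\in S$. A closed line segment is connected if, whenever it is expressed as a union of two disjoint non-empty convex subsets, precisely one of them is a closed line segment. A line is a set $l$ with a betweenness relation, consisting of at least two points, such that for every $A\in l$ the complement $l\setminus\{A\}$ is the union of two disjoint non-empty convex sets $c_1,c_2$ with $A\in s[B,C]$ whenever $B\in c_1$, $C\in c_2$. A line in $\Pi$ is a convex subset of $\Pi$ that is a line with the inherited betweenness. A space with maximal rays is a set with betweenness such that (1) if $s[A,B]$ and $s[A,C]$ have a common interior point, then one of them is contained in the other; (2) if $A\neq B$ and $s[A,B]$ is connected, then there is a connected $s[C,D]$ with $s[A,B]\subset s(C,D)$. If all closed line segments are connected, then every $s[A,B]$ with $A\neq B$ is contained in a largest line in $\Pi$,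 denoted $l(A,B)$; maximal lines are the lines of the form $l(A,B)$. A plane is a space $\Pi$ with maximal rays such that: $\Pi$ contains at least two points; for each pair of different points $A,B$ the segment $s[A,B]$ is connected and $\Pi\setminus l(A,B)$ is the union of two disjoint non-empty convex sets $h_1,h_2$ such that $s[C,D]$ intersects $l(A,B)$ at exactly one point whenever $C\in h_1$ and $D\in h_2$. *)

(* Defs.v *)
From mathcomp Require Import all_boot.
From mathcomp Require Import boolp classical_sets.

Set Implicit Arguments.
Unset Strict Implicit.
Unset Printing Implicit Defensive.

Local Open Scope classical_set_scope.

Section Betweenness.
Variables (T : Type) (btw : T -> T -> T -> Prop).

(* [btw C A B] reads "C is between A and B"; the two endpoints come last. *)
Definition seg (A B : T) : set T := [set C | btw C A B].

Record is_betweenness : Prop := {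
  btw_end : forall A B, btw A A B;
  btw_sym : forall A B C, btw A B C -> btw A C B;
  btw_split : forall A B C, seg A B C ->
    [/\ seg A B = seg A C `|` seg C B,
        seg A C `&` seg C B = seg C C
      & seg C C = [set C]]
}.

Definition seg_int (A B : T) : set T := seg A B `\` [set A; B].

Definition closed_segment (S : set T) : Prop := exists A B, S = seg A B.

Definition convex (S : set T) : Prop :=
  forall A B, S A -> S B -> seg A B `<=` S.

Definition convex_split (S c1 c2 : set T) : Prop :=
  [/\ S = c1 `|` c2, c1 `&` c2 = set0, c1 !=set0 /\ c2 !=set0
    & convex c1 /\ convex c2].

Definition connected_segment (S : set T) : Prop :=
  closed_segment S /\
  forall X Y, convex_split S X Y ->
    (closed_segment X /\ ~ closed_segment Y) \/
    (~ closed_segment X /\ closed_segment Y).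

Record is_line : Prop := {
  line_btw : is_betweenness;
  line_two : exists A B : T, A <> B;
  line_split : forall A, exists c1 c2, convex_split (~` [set A]) c1 c2 /\
    forall B C, c1 B -> c2 C -> seg B C A
}.

Record maximal_rays : Prop := {
  rays_btw : is_betweenness;
  rays_nested : forall A B C, seg_int A B `&` seg_int A C !=set0 ->
    seg A B `<=` seg A C \/ seg A C `<=` seg A B;
  rays_extend : forall A B, A <> B -> connected_segment (seg A B) ->
    exists C D, connected_segment (seg C D) /\ seg A B `<=` seg_int C D
}.

End Betweenness.

Definition inherited (T : Type) (btw : T -> T -> T -> Prop) (l : set T) :
    l -> l -> l -> Prop :=
  fun C A B => btw (val C) (val A) (val B).

Section Plane.
Variables (T : Type) (btw : T -> T -> T -> Prop).

Definition line_in (l : set T) : Prop :=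
  convex btw l /\ is_line (@inherited T btw l).

Definition largest_line (A B : T) (l : set T) : Prop :=
  [/\ line_in l, seg btw A B `<=` l
    & forall m, line_in m -> seg btw A B `<=` m -> m `<=` l].

(* l(A,B). The default set0 is taken only if there is no largest line; this does
   not happen for A <> B in a space with maximal rays whose closed line segments
   are all connected, and is in any case incompatible with [plane_split]. *)
Definition max_line (A B : T) : set T :=
  xget set0 [set l | largest_line A B l].

Lemma max_lineE (A B : T) (l : set T) :
  largest_line A B l -> max_line A B = l.
Proof.
move=> hl; apply: xget_unique => // m hm.
case: hl hm => [l1 l2 l3] [m1 m2 m3].
by apply/seteqP; split; [exact: l3|exact: m3].
Qed.

Definition maximal_line (l : set T) : Prop :=
  exists A B, A <> B /\ l = max_line A B.

Record is_plane : Prop := {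
  plane_rays : maximal_rays btw;
  plane_two : exists A B : T, A <> B;
  plane_connected : forall A B, A <> B -> connected_segment btw (seg btw A B);
  plane_split : forall A B, A <> B -> exists h1 h2,
    convex_split btw (~` max_line A B) h1 h2 /\
    forall C D, h1 C -> h2 D ->
      exists P, seg btw C D `&` max_line A B = [set P]
}.

Definition strong_pasch : Prop :=
  forall A B C, A <> B -> B <> C -> A <> C ->
  forall l, maximal_line l ->
    let meets X Y := seg btw X Y `&` l !=set0 in
    [/\ meets A B -> meets B C \/ meets A C,
        meets B C -> meets A B \/ meets A C
      & meets A C -> meets A B \/ meets B C].

End Plane.

(* Main.v *)
Require Import Defs.
From mathcomp Require Import all_boot.
From mathcomp Require Import boolp classical_sets.

Local Open Scope classical_set_scope.

(** If no vertex lies on the line, the side that it meets joins the two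
    half-planes of its complement, since these are convex.  The third vertex is
    in one of the half-planes, so exactly one of the remaining sides joins them
    too and therefore meets the line. *)

Lemma seg_sym (T : Type) (btw : T -> T -> T -> Prop) (A B : T) :
  is_betweenness btw -> seg btw A B = seg btw B A.
Proof. by move=> hb; apply/seteqP; split=> X; apply: (btw_sym hb). Qed.

Lemma seg_left (T : Type) (btw : T -> T -> T -> Prop) (A B : T) :
  is_betweenness btw -> seg btw A B A.
Proof. by move=> hb; exact: (btw_end hb). Qed.

(** Stated for an arbitrary separating set, this isolates the half-plane argument from the
    construction of [max_line]. As the vertices are arbitrary, one implication yields all three by
    relabelling. *)
Lemma separating_set_pasch (T : Type) (btw : T -> T -> T -> Prop)
    (l h1 h2 : set T) (A B C : T) :
  is_betweenness btw -> convex_split btw (~` l) h1 h2 ->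
  (forall X Y, h1 X -> h2 Y -> seg btw X Y `&` l !=set0) ->
  seg btw A B `&` l !=set0 ->
  seg btw B C `&` l !=set0 \/ seg btw A C `&` l !=set0.
Proof.
move=> hb [lC _ _ [cvx1 cvx2]] sep [X [ABX lX]].
have half Y : ~ l Y -> h1 Y \/ h2 Y.
  by move=> nlY; have : (~` l) Y by []; rewrite lC.
have off Y : h1 Y \/ h2 Y -> ~ l Y.
  by move=> hY; have : (h1 `|` h2) Y by []; rewrite -lC.
(* A vertex on [l] is an endpoint of two sides, so it already witnesses a second side meeting
   [l]. *)
have [lA|/half hA] := pselect (l A).
  by right; exists A; split=> //; exact: seg_left.
have [lB|/half hB] := pselect (l B).
  by left; exists B; split=> //; exact: seg_left.
have [lc|/half hC] := pselect (l C).
  by left; exists C; split=> //; rewrite seg_sym //; exact: seg_left.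
case: hA hB => [A1|A2] [B1|B2].
(* With [A] and [B] in the same half, convexity would put [X] there too, although [X] lies on
   [l]. *)
- by case: (off X) => //; left; exact: cvx1 ABX.
- case: hC => [C1|C2]; last by right; exact: sep.
  (* [sep] takes its [h1] point first, so a side starting in [h2] is reversed. *)
  by left; rewrite seg_sym //; exact: sep.
- case: hC => [C1|C2]; last by left; exact: sep.
  by right; rewrite seg_sym //; exact: sep.
- by case: (off X) => //; right; exact: cvx2 ABX.
Qed.

Theorem lemma17p9 (T : Type) (btw : T -> T -> T -> Prop) :
  is_plane btw -> strong_pasch btw.
Proof.
move=> hp A B C _ _ _ l [P [Q [PQ ->]]] /=.
have hb : is_betweenness btw := rays_btw (plane_rays hp).
have [h1 [h2 [hs hx]]] := plane_split hp PQ.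
have sep X Y : h1 X -> h2 Y -> seg btw X Y `&` max_line btw P Q !=set0.
  by move=> h1X /(hx _ _ h1X)[Z ->]; exists Z.
have pasch X Y Z := @separating_set_pasch _ _ _ _ _ X Y Z hb hs sep.
(* The vertex opposite the side that is met becomes the third point. *)
split=> [|/(pasch _ _ A)|/(pasch _ _ B)]; first exact: pasch.
- by rewrite (seg_sym _ _ C A) // (seg_sym _ _ B A) // => /or_comm.
- by rewrite (seg_sym _ _ C B) // => /or_comm.
Qed.
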